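(* Let $\boldsymbol\phi(n,m,\alpha,\beta,l)\in\mathbb C^N$ satisfy the condition equation set (for all arguments, only the indicated variable shifted) $\sigma_1\boldsymbol\phi(n-1,\cdot,l)=\boldsymbol\phi(n,\cdot,l)-\boldsymbol\phi(n-1,\cdot,l+1)$, $\sigma_2\boldsymbol\phi(m-1,\cdot,l)=\boldsymbol\phi(m,\cdot,l)-\boldsymbol\phi(m-1,\cdot,l+1)$, $\sigma_3\boldsymbol\phi(\alpha-1,\cdot,l)=\boldsymbol\phi(\alpha,\cdot,l)-\boldsymbol\phi(\alpha-1,\cdot,l+1)$, $\sigma_4\boldsymbol\phi(\beta-1,\cdot,l)=\boldsymbol\phi(\beta,\cdot,l)-\boldsymbol\phi(\beta-1,\cdot,l+1)$, and $\boldsymbol K\boldsymbol\phi(l)=\boldsymbol\phi(l+4)-\epsilon_1\boldsymbol\phi(l+3)+\epsilon_2\boldsymbol\phi(l+2)-\epsilon_3\boldsymbol\phi(l+1)$ for a constant $N\times N$ matrix $\boldsymbol K$. Let $f'=|0,\dots,N-1|$, $g'=|0,\dots,N-2,N|$, $h'=|0,\dots,N-2,N+1|$, $s'=|0,\dots,N-3,N-1,N|$ (Casoratians of $\boldsymbol\phi$). Then $$f'(\sigma_3\widetilde{\check f}'+\widetilde{\check g}')+(\sigma_1-\sigma_3)\widetilde f'\check f'-(\sigma_1f'+g')\widetilde{\check f}'=0,\quad f'(\sigma_3\widehat{\check f}'+\widehat{\check g}')+(\sigma_2-\sigma_3)\widehat f'\check f'-(\sigma_2f'+g')\widehat{\check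 f}'=0,$$ $$f'(\sigma_3^2\widetilde{\check f}'+\sigma_3\widetilde{\check g}'+\widetilde{\check s}')-\sigma_1f'(\sigma_3\widetilde{\check f}'+\widetilde{\check g}')+(\sigma_1-\sigma_3)\widetilde f'(\sigma_3\check f'+\check g')-\widetilde{\check f}'s'=0,$$ $$f'(\sigma_3^2\widehat{\check f}'+\sigma_3\widehat{\check g}'+\widehat{\check s}')-\sigma_2f'(\sigma_3\widehat{\check f}'+\widehat{\check g}')+(\sigma_2-\sigma_3)\widehat f'(\sigma_3\check f'+\check g')-\widehat{\check f}'s'=0,$$ $$\widetilde f'(\sigma_1g'+h')-\widetilde g'(\sigma_1f'+g')+f'\widetilde s'=0,\qquad \widehat f'(\sigma_2g'+h')-\widehat g'(\sigma_2f'+g')+f'\widehat s'=0,$$ $$(\sigma_1-\sigma_2)(\widetilde f'\widehat f'-f'\widehat{\widetilde f}')+\widetilde f'\widehat g'-\widehat f'\widetilde g'=0,$$ $$\big[Q(\sigma_1,\sigma_2)\check f'\widehat{\widetilde f}'+\check f'\widehat{\widetilde h}'-(\sigma_1+\sigma_2+\epsilon_1)\check f'\widehat{\widetilde g}'+((\sigma_1+\sigma_2+\epsilon_1)\widehat{\widetilde f}'-\widehat{\widetilde g}')(\sigma_3\check f'+\check g')+\widehat{\widetilde f}'(\sigma_3^2\check f'+\sigma_3\check g'+\check s')\big](\sigma_1-\sigma_2)-R(\sigma_1,\sigma_3)\widehat f'\widetilde{\check f}'+R(\sigma_2,\sigma_3)\widetilde f'\widehat{\check f}'=0.$$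
   Context: Fix $\alpha_1,\alpha_2,\alpha_3,\delta\in\mathbb C$ and pairwise distinct $p,q,a,b\in\mathbb C$. Put $\sigma_1=p-\delta$, $\sigma_2=q-\delta$, $\sigma_3=a-\delta$, $\sigma_4=b-\delta$; $\epsilon_1=4\delta-\alpha_3$, $\epsilon_2=6\delta^2-3\delta\alpha_3+\alpha_2$, $\epsilon_3=4\delta^3-3\delta^2\alpha_3+2\delta\alpha_2-\alpha_1$; $Q(x,y)=(x+y)^2-xy+\epsilon_1(x+y)+\epsilon_2$; $R(x,y)=(x+y)(x^2+y^2)+\epsilon_1((x+y)^2-xy)+\epsilon_2(x+y)+\epsilon_3$. Casoratian notation: $|l_1,\dots,l_N|=\det(\boldsymbol\phi(l_1),\dots,\boldsymbol\phi(l_N))$ with $\boldsymbol\phi(l)=\boldsymbol\phi(n,m,\alpha,\beta,l)$; a run ''$0,\dots,j$'' with $j<0$ is empty, and if the listed indices number more than $N$ the symbol is $0$. Shifts: $\widetilde F=F(n+1,m,\alpha)$, $\widehat F=F(n,m+1,\alpha)$, $\check F=F(n,m,\alpha-1)$, composed as needed. *)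

(* Defs.v *)
From HB Require Import structures.
From mathcomp Require Import all_boot all_order all_algebra.
Set Implicit Arguments. Unset Strict Implicit. Unset Printing Implicit Defensive.
Import Order.TTheory GRing.Theory Num.Theory.
Local Open Scope ring_scope.

(* Casoratian |l_1,...,l_k| of a family v : nat -> C^N (column vectors):
   the determinant of the N x N matrix whose j-th column is v (l_j) when
   exactly N indices are listed; 0 otherwise (the paper's convention for
   more than N indices; fewer than N never occurs below). *)
Definition casor (C : comRingType) (N : nat) (v : nat -> 'cV[C]_N)
  (ls : seq nat) : C :=
  if size ls == N then \det (\matrix_(i < N, j < N) v (nth 0%N ls j) i ord0)
  else 0.

(* index lists:  f' = |0..N-1|, g' = |0..N-2,N|, h' = |0..N-2,N+1|,
   s' = |0..N-3,N-1,N|  (runs 0..j with j<0 are empty) *)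
Definition fidx (N : nat) : seq nat := iota 0 N.
Definition gidx (N : nat) : seq nat := iota 0 N.-1 ++ [:: N].
Definition hidx (N : nat) : seq nat := iota 0 N.-1 ++ [:: N.+1].
Definition sidx (N : nat) : seq nat := iota 0 (N - 2) ++ [:: N.-1; N].

Definition Qpol (C : comRingType) (e1 e2 x y : C) : C :=
  (x + y) ^+ 2 - x * y + e1 * (x + y) + e2.
Definition Rpol (C : comRingType) (e1 e2 e3 x y : C) : C :=
  (x + y) * (x ^+ 2 + y ^+ 2) + e1 * ((x + y) ^+ 2 - x * y) + e2 * (x + y) + e3.

(* Main.v *)
(* Let v = phi(n,m,alpha-1,beta,.), extended to polynomials by X^l |-> v(l).
   Each shift multiplies by X + sigma_i, so every Casoratian is the determinant
   of the images of N polynomials in one linear map. By Cramer's rule the map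
   kills p = sum_i (-1)^(N+i) M_i X^i, where M_i is the minor of v(0), ..., v(N)
   omitting v(i); the top coefficients of p are f, -g, s and its value at -sigma
   is, up to sign, the f attached to (X + sigma) v. Applying determinants with
   N-1 fixed columns to p or its multiples gives the bilinear equations. For the
   last one, D = X^4 - e1 X^3 + e2 X^2 - e3 X acts as K, so D p is killed
   together with p; hence (D - D(-sigma_3)) p / (X + sigma_3) is killed for the
   sequence (X + sigma_3) v, and interpolating it at -sigma_1, -sigma_2 produces
   the coefficients -R(sigma_i, sigma_3). *)
Require Import Defs.
From HB Require Import structures.
From mathcomp Require Import all_boot all_order all_algebra.
From mathcomp Require Import perm zify ring.
Import Order.TTheory GRing.Theory Num.Theory.
Set Implicit Arguments. Unset Strict Implicit. Unset Printing Implicit Defensive.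
Local Open Scope ring_scope.

Section Casoratian.
Variable C : comNzRingType.
Implicit Types (N n : nat) (s t : C) (P : {poly C}).

(** * Determinants as functions of their columns *)

Definition cdet N (u : nat -> 'cV[C]_N) : C := \det (\matrix_(i, j) u j i ord0).

(** The linear functional that turns a vanishing vector combination into a scalar bilinear
    identity. *)
Definition lastdet n (b : nat -> 'cV[C]_n.+1) (w : 'cV[C]_n.+1) : C :=
  cdet (fun j => if (j < n)%N then b j else w).

Definition minor N (v : nat -> 'cV[C]_N) (i : nat) : C :=
  cdet (fun j => v (bump i j)).

Definition shiftv N s (v : nat -> 'cV[C]_N) (l : nat) : 'cV[C]_N :=
  v l.+1 + s *: v l.

Lemma shiftvC N s t (v : nat -> 'cV[C]_N) :
  shiftv s (shiftv t v) =1 shiftv t (shiftv s v).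
Proof.
move=> l; rewrite /shiftv !scalerDr !scalerA [s * t]mulrC.
by rewrite !addrA; congr (_ + _); rewrite addrAC.
Qed.

Definition pcomb N (v : nat -> 'cV[C]_N) P : 'cV[C]_N :=
  \sum_(i < size P) P`_i *: v i.

Lemma eq_cdet N (u v : nat -> 'cV[C]_N) :
  (forall j, (j < N)%N -> u j = v j) -> cdet u = cdet v.
Proof.
by move=> uv; congr (\det _); apply/matrixP => i j; rewrite !mxE uv.
Qed.

Lemma cdet_alternate N (u : nat -> 'cV[C]_N) (j k : nat) :
  (j < N)%N -> (k < N)%N -> j != k -> u j = u k -> cdet u = 0.
Proof.
move=> jN kN jk ujk; rewrite /cdet -det_tr.
apply: (@determinant_alternate _ _ _ (Ordinal jN) (Ordinal kN)) => //.
by move=> i; rewrite !mxE /= ujk.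
Qed.

Lemma cdet_mulmx N (u w : nat -> 'cV[C]_N) (T : 'M[C]_N) :
  (forall j : 'I_N, w j = \sum_(k < N) T k j *: u k) ->
  cdet w = cdet u * \det T.
Proof.
move=> wE; rewrite /cdet -det_mulmx; congr (\det _).
apply/matrixP => i j; rewrite !mxE wE summxE.
by apply: eq_bigr => k _; rewrite !mxE mulrC.
Qed.

Lemma lastdet_is_linear n (b : nat -> 'cV[C]_n.+1) :
  linear_for *%R (lastdet b).
Proof.
have lastE w : lastdet b w = \sum_i w i ord0 *
    cofactor (\matrix_(i, j) (if (j < n)%N then b j else 0) i ord0) i ord_max.
  rewrite /lastdet /cdet (expand_det_col _ ord_max); apply: eq_bigr => i _.
  rewrite !mxE /= ltnn; congr (_ * (_ * \det _)).
  apply/matrixP => k l; rewrite !mxE.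
  by have -> : (lift ord_max l < n)%N by rewrite lift_max.
move=> c x y; rewrite !lastE big_distrr -big_split /=.
by apply: eq_bigr => i _; rewrite !mxE mulrDl mulrA.
Qed.

HB.instance Definition _ n (b : nat -> 'cV[C]_n.+1) :=
  GRing.isLinear.Build C 'cV[C]_n.+1 C _ (lastdet b) (@lastdet_is_linear n b).

Lemma lastdet_mem n (b : nat -> 'cV[C]_n.+1) (j : nat) :
  (j < n)%N -> lastdet b (b j) = 0.
Proof.
move=> jn; apply: (@cdet_alternate _ _ j n) => //; last by rewrite jn ltnn.
  exact: ltnW.
by rewrite neq_ltn jn.
Qed.

Lemma eq_lastdet n (b b' : nat -> 'cV[C]_n.+1) w :
  (forall j, (j < n)%N -> b j = b' j) -> lastdet b w = lastdet b' w.
Proof. by move=> bb; apply: eq_cdet => j _; case: ifP => // /bb. Qed.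

Lemma cdetE n (v : nat -> 'cV[C]_n.+1) : cdet v = lastdet v (v n).
Proof.
apply: eq_cdet => j; rewrite ltnS leq_eqVlt => /predU1P[->|->] //.
by rewrite ltnn.
Qed.

(* The lower-bidiagonal change of columns, followed by a cyclic permutation. *)
Lemma cdet_cycle n (x : nat -> 'cV[C]_n.+1) (c : nat -> C) :
  lastdet (fun j => x j.+1 + c j *: x j) (x 0%N) = (-1) ^+ n * cdet x.
Proof.
pose T : 'M[C]_n.+1 := \matrix_(k, j)
  if (j < n)%N then (k == j.+1 :> nat)%:R + c j *+ (k == j :> nat)
  else (k == 0%N :> nat)%:R.
rewrite /lastdet (@cdet_mulmx _ x _ T); last first.
  move=> j; case: ifPn => jn; last first.
    rewrite (bigD1 ord0) //= mxE (negPf jn) scale1r big1 ?addr0 // => k k0.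
    by rewrite mxE (negPf jn) (negPf (k0 : (k != 0%N :> nat))) scale0r.
  have jn1 : (j.+1 < n.+1)%N by [].
  rewrite (eq_bigr (fun k : 'I_n.+1 => (k == Ordinal jn1)%:R *: x k
             + (c j *+ (k == j)) *: x k)); last first.
    by move=> k _; rewrite mxE jn scalerDl.
  rewrite big_split /=; congr (_ + _).
    rewrite (bigD1 (Ordinal jn1)) // eqxx scale1r big1 /= ?addr0 //.
    by move=> k /negPf ->; rewrite scale0r.
  rewrite (bigD1 j) // eqxx mulr1n big1 /= ?addr0 //.
  by move=> k /negPf ->; rewrite scale0r.
rewrite mulrC; congr (_ * _).
(* The last column of [T] is the first unit vector; removing it together with row [0] leaves an
   upper unitriangular matrix, so [\det T] is the cofactor sign alone. *)
rewrite (expand_det_col _ ord_max) (bigD1 ord0) //= big1 ?addr0; last first.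
  by move=> k k0; rewrite mxE /= ltnn (negPf (k0 : (k != 0%N :> nat))) mul0r.
rewrite mxE /= ltnn mul1r /cofactor /= add0n -[RHS]mulr1; congr (_ * _).
rewrite -det_tr det_trig; last first.
  apply/is_trig_mxP => i j ij; rewrite !mxE lift_max (ltn_ord i).
  by rewrite lift0 eqSS !gtn_eqF ?addr0 ?mulr0n // leqW.
apply: big1 => i _; rewrite !mxE lift_max (ltn_ord i) lift0 eqxx.
by rewrite gtn_eqF // mulr0n addr0.
Qed.

(** Laplace expansion along the bordering row. Powers of [- s] in that row lead to [cdet_shiftv]; a
    copy of a row of [v] leads to Cramer's rule in [pcomb_kerp]. *)
Lemma det_bordered N (v : nat -> 'cV[C]_N) (c : nat -> C) :
  \det (col_mx (\row_(j < 1 + N) c j) (\matrix_(i < N, j < 1 + N) v j i ord0))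
  = \sum_(i < N.+1) c i * ((-1) ^+ i * minor v i).
Proof.
rewrite (expand_det_row _ (lshift N ord0)); apply: eq_bigr => j _.
rewrite col_mxEu mxE /cofactor; congr (_ * (_ * \det _)).
apply/matrixP => i k; rewrite [LHS]mxE [LHS]mxE.
have -> : lift (lshift N ord0) i = rshift 1 i by apply: val_inj.
by rewrite col_mxEd !mxE.
Qed.

(** Border [v] by the row of powers of [- s]. Adding [s] times each column to the next one clears
    that row except in column [0], so the bordered determinant equals that of [shiftv s v]. *)
Lemma cdet_shiftv N s (v : nat -> 'cV[C]_N) :
  cdet (shiftv s v) = \sum_(i < N.+1) s ^+ i * minor v i.
Proof.
pose y j : 'cV[C]_N.+1 := col_mx ((- s) ^+ j)%:M (v j).
have yE : cdet y = \sum_(i < N.+1) s ^+ i * minor v i.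
  transitivity (\sum_(i < N.+1) (- s) ^+ i * ((-1) ^+ i * minor v i)).
    rewrite -det_bordered; congr (\det _); apply/matrixP => i j; rewrite !mxE.
    by case: split => k; rewrite !mxE // ord1.
  apply: eq_bigr => i _; rewrite mulrA -exprMn_comm; last exact: mulrC.
  by rewrite mulrN1 opprK.
have y0 j : y j ord0 ord0 = (- s) ^+ j.
  have -> : ord0 = lshift N ord0 :> 'I_(1 + N) by apply: val_inj.
  by apply: etrans (col_mxEu _ _ _ _) _; rewrite mxE eqxx.
have yS j i : y j (lift ord0 i) ord0 = v j i ord0.
  have -> : lift ord0 i = rshift 1 i by apply: val_inj.
  exact: col_mxEd.
clearbody y; rewrite -yE; apply: (can_inj (signrMK N)).
rewrite -(cdet_cycle y (fun=> s)).
rewrite /lastdet /cdet (expand_det_row _ ord0) (bigD1 ord_max) //= big1 ?addr0.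
  rewrite mxE /= ltnn y0 expr0 mul1r.
  rewrite /cofactor /= add0n; congr (_ * \det _).
  apply/matrixP => i j; rewrite [LHS]mxE 3![in RHS]mxE lift_max (ltn_ord j).
  by rewrite !mxE !yS.
move=> j jN; rewrite mxE; case: ifPn => [_|]; last first.
  rewrite -leqNgt => Nj; case/eqP: jN; apply: val_inj => /=.
  by apply/eqP; rewrite eqn_leq Nj -ltnS ltn_ord.
by rewrite !mxE !y0 exprS mulNr addNr mul0r.
Qed.

(** * The linear map sending ['X^l] to [v l] *)

Lemma pcomb_wide N (v : nat -> 'cV[C]_N) P m :
  (size P <= m)%N -> pcomb v P = \sum_(i < m) P`_i *: v i.
Proof.
move=> Pm; rewrite /pcomb (big_ord_widen m (fun i => P`_i *: v i) Pm).
rewrite big_mkcond; apply: eq_bigr => i _; case: ltnP => // Pi.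
by rewrite nth_default // scale0r.
Qed.

Lemma pcomb_is_linear N (v : nat -> 'cV[C]_N) : linear (pcomb v).
Proof.
move=> c P Q; set m := maxn (size P) (size Q).
have Pm : (size P <= m)%N by rewrite leq_maxl.
have Qm : (size Q <= m)%N by rewrite leq_maxr.
have cPQm : (size (c *: P + Q)%R <= m)%N.
  rewrite (leq_trans (size_polyD _ _)) // geq_max Qm.
  by rewrite (leq_trans (size_scale_leq _ _)).
rewrite !(@pcomb_wide _ v _ m) // scaler_sumr -big_split; apply: eq_bigr => i _.
by rewrite coefD coefZ scalerDl scalerA.
Qed.

HB.instance Definition _ N (v : nat -> 'cV[C]_N) :=
  GRing.isLinear.Build C {poly C} 'cV[C]_N _ (pcomb v) (@pcomb_is_linear N v).

Lemma pcombX N (v : nat -> 'cV[C]_N) P :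
  pcomb v ('X * P) = pcomb (fun l => v l.+1) P.
Proof.
have sz : (size ('X * P)%R <= (size P).+1)%N.
  by rewrite (leq_trans (size_polyMleq _ _)) // size_polyX.
rewrite (pcomb_wide _ sz) big_ord_recl coefXM scale0r add0r.
by apply: eq_bigr => i _; rewrite coefXM.
Qed.

Lemma pcombC N (v : nat -> 'cV[C]_N) c : pcomb v c%:P = c *: v 0%N.
Proof. by rewrite (pcomb_wide _ (size_polyC_leq1 c)) big_ord1 coefC. Qed.

Lemma pcomb_mulC N (v : nat -> 'cV[C]_N) c P :
  pcomb v (c%:P * P) = c *: pcomb v P.
Proof. by rewrite mul_polyC linearZ. Qed.

Lemma pcomb_XD N (v : nat -> 'cV[C]_N) s P :
  pcomb v (('X + s%:P) * P) = pcomb (shiftv s v) P.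
Proof.
rewrite mulrDl linearD /= pcombX pcomb_mulC /pcomb scaler_sumr -big_split.
by apply: eq_bigr => i _; rewrite scalerDr !scalerA mulrC.
Qed.

(** Terms of degree below [n] repeat a fixed column, so only the top coefficients survive. *)
Lemma lastdet_pcomb n k (w : nat -> 'cV[C]_n.+1) P : (size P <= n + k)%N ->
  lastdet w (pcomb w P) = \sum_(i < k) P`_(n + i) * lastdet w (w (n + i)%N).
Proof.
move=> /(pcomb_wide w) ->; rewrite linear_sum big_split_ord /= big1 => [|i _].
  by rewrite add0r; apply: eq_bigr => i _; rewrite linearZ.
by rewrite linearZ /= lastdet_mem // mulr0.
Qed.

(** * The polynomial killed by a sequence of vectors, and its division by ['X + s%:P] *)

Definition kerp N (v : nat -> 'cV[C]_N) : {poly C} :=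
  \poly_(i < N.+1) ((-1) ^+ (N + i) * minor v i).

(** Coordinate [r] is, up to sign, the determinant bordered by a copy of row [r], which has two
    equal rows. *)
Lemma pcomb_kerp N (v : nat -> 'cV[C]_N) : pcomb v (kerp v) = 0.
Proof.
apply/matrixP => r z; rewrite ord1 (pcomb_wide _ (size_poly _ _)) summxE mxE.
transitivity ((-1) ^+ N * \sum_(i < N.+1) v i r ord0 * ((-1) ^+ i * minor v i)).
  rewrite big_distrr; apply: eq_bigr => i _ /=.
  by rewrite mxE coef_poly ltn_ord exprD [v i r _ * _]mulrC !mulrA.
rewrite -(det_bordered v (fun j => v j r ord0)).
rewrite (determinant_alternate (i1 := lshift N ord0)
  (i2 := rshift 1 r)) ?mulr0 // => i.
by rewrite col_mxEu col_mxEd !mxE.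
Qed.

Lemma horner_kerp N (v : nat -> 'cV[C]_N) s :
  (kerp v).[- s] = (-1) ^+ N * cdet (shiftv s v).
Proof.
rewrite horner_poly cdet_shiftv big_distrr; apply: eq_bigr => i _ /=.
rewrite exprD -!mulrA; congr (_ * _).
by rewrite mulrC -mulrA -exprMn mulrN1 opprK mulrC.
Qed.

(** The coefficient relation is Horner's scheme: read from the top, it yields the leading
    coefficients of [q] one by one. *)
Lemma horner_rem P s m : (size P <= m.+1)%N -> exists q : {poly C},
  [/\ P = P.[- s]%:P + ('X + s%:P) * q, (size q <= m)%N
    & forall i, P`_i.+1 = q`_i + s * q`_i.+1].
Proof.
move=> Pm; have /factor_theorem [q qE] : root (P - P.[- s]%:P) (- s).
  by rewrite rootE hornerD hornerN hornerC subrr.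
have PE : P = P.[- s]%:P + ('X + s%:P) * q.
  by rewrite mulrC -[s in 'X + s%:P]opprK polyCN -qE addrC subrK.
exists q; split=> // [|i]; last first.
  by rewrite {1}PE coefD coefC add0r mulrDl coefD coefXM coefCM.
have [->|q0] := eqVneq q 0; first by rewrite size_poly0.
rewrite -ltnS; have := size_Mmonic q0 (monicXsubC (- s)).
rewrite size_XsubC addn2 /= -qE => <-.
rewrite (leq_trans (size_polyD _ _)) // geq_max Pm size_polyN.
by rewrite (leq_trans (size_polyC_leq1 _)).
Qed.

(** * The four Casoratians as values of [lastdet] and as coefficients of [kerp] *)

Definition casf N (v : nat -> 'cV[C]_N) := casor v (fidx N).
Definition casg N (v : nat -> 'cV[C]_N) := casor v (gidx N).
Definition cash N (v : nat -> 'cV[C]_N) := casor v (hidx N).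
Definition cass N (v : nat -> 'cV[C]_N) := casor v (sidx N).

Lemma eq_casor N (u v : nat -> 'cV[C]_N) ls : u =1 v -> casor u ls = casor v ls.
Proof.
move=> uv; rewrite /casor; case: eqP => // _; congr (\det _).
by apply/matrixP => i j; rewrite !mxE uv.
Qed.

Lemma casor_cdet N (v : nat -> 'cV[C]_N) ls :
  size ls = N -> casor v ls = cdet (fun j => v (nth 0%N ls j)).
Proof. by rewrite /casor => ->; rewrite eqxx. Qed.

Lemma casfE N (v : nat -> 'cV[C]_N) : casf v = cdet v.
Proof.
rewrite /casf casor_cdet ?size_iota //; apply: eq_cdet => j jN.
by rewrite nth_iota.
Qed.

Lemma casor_rcons n (v : nat -> 'cV[C]_n.+1) i :
  casor v (iota 0 n ++ [:: i]) = lastdet v (v i).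
Proof.
rewrite casor_cdet; last by rewrite size_cat size_iota addn1.
apply: eq_cdet => j; rewrite ltnS leq_eqVlt nth_cat size_iota.
case/predU1P=> [->|jn]; last by rewrite jn nth_iota.
by rewrite ltnn subnn.
Qed.

Lemma cassE n (v : nat -> 'cV[C]_n.+2) :
  cass v = lastdet (fun j => v (bump n j)) (v n.+2).
Proof.
rewrite /cass casor_cdet /sidx subSS subSS subn0; last first.
  by rewrite size_cat size_iota addn2.
apply: eq_cdet => j; rewrite ltnS /bump nth_cat size_iota leq_eqVlt ltnS.
case/predU1P=> [->|jn]; first by rewrite ltnn ltnNge leqnSn subSn // subnn.
rewrite jn; move: jn; rewrite leq_eqVlt => /predU1P[->|jn].
  by rewrite ltnn subnn leqnn.
by rewrite jn nth_iota // leqNgt jn.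
Qed.

(** Evaluates the constant remainder of a division by ['X + s%:P], since [pcomb v] sends constants
    to multiples of [v 0]. *)
Lemma lastdet_shiftv n s (v : nat -> 'cV[C]_n.+1) :
  lastdet (shiftv s v) (v 0%N) = (-1) ^+ n * casf v.
Proof. by rewrite casfE -(cdet_cycle v (fun=> s)). Qed.

Lemma size_kerp N (v : nat -> 'cV[C]_N) : (size (kerp v) <= N.+1)%N.
Proof. exact: size_poly. Qed.

(** The sign [(-1) ^+ (N + i)] in [kerp] is chosen to cancel here. *)
Lemma kerp_lead N (v : nat -> 'cV[C]_N) : (kerp v)`_N = casf v.
Proof.
rewrite coef_poly leqnn -signr_odd oddD addbb mul1r casfE.
apply: eq_cdet => j jN.
by rewrite /bump leqNgt jN.
Qed.

Lemma kerp_sublead n (v : nat -> 'cV[C]_n.+1) : (kerp v)`_n = - casg v.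
Proof.
rewrite coef_poly leqnSn -signr_odd addSn oddS oddD addbb mulN1r.
rewrite [casg v]casor_rcons.
congr (- _); apply: eq_cdet => j; rewrite ltnS leq_eqVlt /bump.
by case: ltngtP => // -> .
Qed.

(** The factor ['X] replaces the index [n.-1]: for [n = 0] the coefficient is then 0, in agreement
    with the convention for [cass]. *)
Lemma kerp_subsublead n (v : nat -> 'cV[C]_n.+1) : ('X * kerp v)`_n = cass v.
Proof.
rewrite coefXM; case: n v => [|n] v /=; first by rewrite /cass /casor.
rewrite coef_poly leqW // -signr_odd !addSn !oddS negbK oddD addbb mul1r cassE.
apply: eq_cdet => j; rewrite ltnS leq_eqVlt => /predU1P[->|-> //].
by rewrite ltnn /bump leqnSn.
Qed.

Lemma casgE n (v : nat -> 'cV[C]_n.+1) : casg v = lastdet v (v n.+1).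
Proof. exact: casor_rcons. Qed.

Lemma cashE n (v : nat -> 'cV[C]_n.+1) : cash v = lastdet v (v n.+2).
Proof. exact: casor_rcons. Qed.

Lemma casfE_last n (v : nat -> 'cV[C]_n.+1) : casf v = lastdet v (v n).
Proof. by rewrite casfE cdetE. Qed.

(* For N = 0 the lists of g', h' and s' are too long, and so is that of s' for
   N = 1: these Casoratians are 0. *)
Lemma casf0 (v : nat -> 'cV[C]_0) : casf v = 1.
Proof. by rewrite casfE [LHS]det_mx00. Qed.

Lemma casg0 (v : nat -> 'cV[C]_0) : casg v = 0. Proof. by []. Qed.
Lemma cash0 (v : nat -> 'cV[C]_0) : cash v = 0. Proof. by []. Qed.
Lemma cass0 (v : nat -> 'cV[C]_0) : cass v = 0. Proof. by []. Qed.
Lemma cass1 (v : nat -> 'cV[C]_1) : cass v = 0. Proof. by []. Qed.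

(** * The bilinear equations that do not involve [K] *)

Lemma kerp_rem n s (v : nat -> 'cV[C]_n.+1) : exists q : {poly C},
  [/\ kerp v = ((-1) ^+ n.+1 * casf (shiftv s v))%:P + ('X + s%:P) * q,
      (size q <= n.+1)%N, q`_n = casf v
    & forall k, k.+1 = n -> q`_k = - casg v - s * casf v].
Proof.
have [q [pE szq qE]] := horner_rem s (size_kerp v).
have qn : q`_n = casf v.
  by rewrite -kerp_lead qE (nth_default _ szq) mulr0 addr0.
exists q; split=> //.
- by rewrite {1}pE horner_kerp casfE.
- by move=> k kn; have := qE k; rewrite kn kerp_sublead qn => ->; rewrite addrK.
Qed.

Lemma signr_SM n x y : (-1) ^+ n.+1 * x * ((-1) ^+ n * y) = - (x * y) :> C.
Proof. by rewrite mulrACA -exprD -signr_odd addSn oddS oddD addbb mulN1r. Qed.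

(** Since [X + s = (X + t) + (s - t)], it suffices that [v] kills [X + t] times [kerp (shiftv t v)],
    that is, that [shiftv t v] kills its own [kerp]. *)
Lemma kerp_shiftv n s t (v : nat -> 'cV[C]_n.+1) :
  pcomb (shiftv s v) (kerp (shiftv t v)) +
    (t - s) *: pcomb v (kerp (shiftv t v)) = 0.
Proof.
rewrite -pcomb_XD -pcomb_mulC -linearD /= -mulrDl polyCB addrA addrAC.
by rewrite addrK pcomb_XD pcomb_kerp.
Qed.

(** [kerp_shiftv] evaluated against the first [N - 1] columns of [shiftv s v]. *)
Lemma casf_casg_shift N s t (v : nat -> 'cV[C]_N) :
  casf (shiftv t v) * (t * casf (shiftv s v) + casg (shiftv s v))
  + (s - t) * casf (shiftv s (shiftv t v)) * casf v
  - (s * casf (shiftv t v) + casg (shiftv t v)) * casf (shiftv s v) = 0.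
Proof.
case: N v => [|n] v; first by rewrite !casf0 !casg0; ring.
set w := shiftv s v; set u := shiftv t v.
have [q [pE szq qn _]] := kerp_rem s u.
have := congr1 (lastdet w) (kerp_shiftv s t v); rewrite -/u -/w.
rewrite linear0 linearD linearZ /=.
(* Only the copy evaluated on [v] is divided by ['X + s%:P]: its remainder gives a multiple of
   [v 0], and its quotient is evaluated on [w]. *)
rewrite {2}pE linearD /= linearD pcombC linearZ /= lastdet_shiftv pcomb_XD -/w.
rewrite (@lastdet_pcomb n 2) ?addn2 ?size_kerp //.
rewrite (@lastdet_pcomb n 1) ?addn1 //.
rewrite !big_ord_recl !big_ord0 !addr0 /= /bump /= addn0 addn1.
rewrite qn kerp_lead kerp_sublead -!casfE_last -casgE.
rewrite signr_SM => H0; rewrite -[RHS]H0; ring.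
Qed.

(** The same vector identity as before, now against the columns of [shiftv s v] that occur in s'
    before the last one. *)
Lemma casg_cass_shift N s t (v : nat -> 'cV[C]_N) :
  casf (shiftv t v) * (t ^+ 2 * casf (shiftv s v) + t * casg (shiftv s v)
                       + cass (shiftv s v))
  - s * casf (shiftv t v) * (t * casf (shiftv s v) + casg (shiftv s v))
  + (s - t) * casf (shiftv s (shiftv t v)) * (t * casf v + casg v)
  - casf (shiftv s v) * cass (shiftv t v) = 0.
Proof.
case: N v => [|[|n]] v; first by rewrite !casf0 !casg0 !cass0; ring.
  (* For [N = 1] there is no column to skip; the Casoratians are the entries themselves and s' is
     0. *)
  have eq1 r (x : nat -> 'cV[C]_1) : casf (shiftv r x) = r * casf x + casg x.
    rewrite !casfE_last casgE /shiftv linearD linearZ /= addrC.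
    by congr (_ + _); apply: eq_lastdet.
  have -> : casf (shiftv s (shiftv t v))
            = t * casf (shiftv s v) + casg (shiftv s v).
    by rewrite -eq1; apply/eq_casor/shiftvC.
  by rewrite !cass1 eq1; ring.
have H1 := casf_casg_shift s t v.
set w := shiftv s v in H1 *; set u := shiftv t v in H1 *.
have [q [pE szq _ qn]] := kerp_rem s u.
pose b j := w (bump n j).
(* The columns are the consecutive ones with the last two exchanged. *)
have bw : lastdet b (w n) = - casf w.
  rewrite casfE /cdet -(mulN1r (\det _)) /lastdet /cdet.
  pose i0 : 'I_n.+2 := Ordinal (leqnSn n.+1).
  pose tau := tperm i0 ord_max.
  have <- : \det (perm_mx tau^-1) = -1 :> C.
    by rewrite det_perm odd_permV odd_tperm neq_ltn leqnn expr1.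
  rewrite mulrC -det_mulmx -col_permE; congr (\det _).
  apply/matrixP => i j; rewrite [LHS]mxE [RHS]mxE [RHS]mxE.
  suff -> : (if (j < n.+1)%N then b j else w n) = w (tau j) by [].
  rewrite /tau; case: tpermP => [->|->|/eqP jn /eqP jn1] /=.
  - by rewrite leqnn /b /bump leqnn.
  - by rewrite ltnn.
  rewrite -val_eqE /= in jn; rewrite -val_eqE /= in jn1.
  have jlt : (j < n)%N by have := ltn_ord j; lia.
  by rewrite ltnS ltnW // /b /bump leqNgt jlt.
have bv : lastdet b (v 0%N) = (-1) ^+ n.+1 * (casg v + s * casf v).
  (* Column [n] of [b] is [w n.+1] itself, without a multiple of its predecessor; hence [c] vanishes
     at [n] and [w n.+1] closes the list [x]. *)
  pose x j := if (j <= n)%N then v j else w n.+1.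
  pose c j := if (j < n)%N then s else 0.
  have -> : casg v + s * casf v = cdet x.
    by rewrite casgE casfE_last -linearZ -linearD.
  rewrite -(cdet_cycle x c); apply: eq_lastdet => j.
  rewrite ltnS leq_eqVlt /b /x /c /bump => /predU1P[->|jn].
    by rewrite leqnn ltnn scale0r addr0.
  by rewrite leqNgt jn (ltnW jn).
have bwE P : (size P <= n.+3)%N ->
    lastdet b (pcomb w P) = P`_n.+2 * cass w - P`_n * casf w.
  move=> szP; rewrite (pcomb_wide _ szP) linear_sum !big_ord_recr /=.
  rewrite big1 => [|i _]; last first.
    rewrite linearZ /= (_ : w i = b i) ?lastdet_mem ?mulr0 ?ltnS 1?ltnW //.
    by rewrite /b /bump leqNgt ltn_ord.
  rewrite add0r !linearZ /= bw cassE (_ : w n.+1 = b n); last first.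
    by rewrite /b /bump leqnn.
  by rewrite lastdet_mem // mulr0 addr0 mulrN addrC.
have := congr1 (lastdet b) (kerp_shiftv s t v); rewrite -/u -/w.
rewrite linear0 linearD linearZ /=.
rewrite {2}pE linearD /= linearD pcombC linearZ /= pcomb_XD -/w.
rewrite !bwE ?size_kerp ?(leqW szq) // (nth_default _ szq) qn //.
have -> : (kerp u)`_n = cass u by rewrite -kerp_subsublead coefXM.
rewrite kerp_lead bv signr_SM => H0.
(* The goal is [H0] plus [t - s] times [H1]; the latter trades [casg v + s * casf v] for
   [t * casf v + casg v]. *)
rewrite -[RHS]addr0 -[X in _ = X + _]H0 -[X in _ = _ + X](mulr0 (t - s)).
rewrite -[X in _ = _ + _ * X]H1; ring.
Qed.

(** [v] kills [P], of degree at most [n + 2]; its coefficients of degrees [n], [n + 1], [n + 2]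
    multiply f', g', h' of [v]. *)
Lemma casf_cash_shift N s (v : nat -> 'cV[C]_N) :
  casf (shiftv s v) * (s * casg v + cash v)
  - casg (shiftv s v) * (s * casf v + casg v) + casf v * cass (shiftv s v) = 0.
Proof.
case: N v => [|n] v; first by rewrite !casf0 !casg0 !cash0 !cass0; ring.
set w := shiftv s v; set P := ('X + s%:P) * kerp w.
have PE k : P`_k = ('X * kerp w)`_k + s * (kerp w)`_k.
  by rewrite /P mulrDl coefD coefCM.
have szP : (size P <= n + 3)%N.
  have := size_polyMleq ('X + s%:P) (kerp w); rewrite size_XaddC /=.
  by move=> /leq_trans -> //; rewrite addn3 !ltnS size_kerp.
have : lastdet v (pcomb v P) = 0 by rewrite pcomb_XD pcomb_kerp linear0.
rewrite (lastdet_pcomb _ szP) !big_ord_recl big_ord0 addr0 /= /bump /=.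
rewrite addn0 addn1 addn2.
rewrite -casfE_last -casgE -cashE !PE kerp_subsublead !coefXM /=.
rewrite kerp_lead kerp_sublead (nth_default _ (size_kerp w)) => H0.
rewrite -[RHS]H0; ring.
Qed.

(** * The equation that uses the quartic condition on [K] *)

Lemma pcomb_quartic N (K : 'M[C]_N) e1 e2 e3 (v : nat -> 'cV[C]_N) P :
  (forall l, K *m v l = v l.+4 - e1 *: v l.+3 + e2 *: v l.+2 - e3 *: v l.+1) ->
  pcomb v ('X * ('X * ('X * ('X * P))) - e1%:P * ('X * ('X * ('X * P)))
           + e2%:P * ('X * ('X * P)) - e3%:P * ('X * P)) = K *m pcomb v P.
Proof.
move=> Kv; rewrite !(linearB, linearD) /= !pcomb_mulC !pcombX /pcomb.
rewrite mulmx_sumr !scaler_sumr -sumrB -big_split -sumrB; apply: eq_bigr => i _.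
rewrite -scalemxAr Kv /= !(scalerDr, scalerN, scalerA).
by rewrite ![_ * P`_i]mulrC.
Qed.

(** The bracket with [Qpol] is the determinant of the quotient of [P] by [(X + s1)(X + s2)]; the
    [Rpol] terms come from the interpolated remainder. *)
Lemma casf_quartic_shift N (K : 'M[C]_N) e1 e2 e3 s1 s2 t
    (v : nat -> 'cV[C]_N) :
  (forall l, K *m v l = v l.+4 - e1 *: v l.+3 + e2 *: v l.+2 - e3 *: v l.+1) ->
  let u := shiftv t v in let w := shiftv s2 (shiftv s1 u) in
  (Qpol e1 e2 s1 s2 * casf v * casf w + casf v * cash w
    - (s1 + s2 + e1) * casf v * casg w
    + ((s1 + s2 + e1) * casf w - casg w) * (t * casf v + casg v)
    + casf w * (t ^+ 2 * casf v + t * casg v + cass v)) * (s1 - s2)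
  - Rpol e1 e2 e3 s1 t * casf (shiftv s2 u) * casf (shiftv s1 v)
  + Rpol e1 e2 e3 s2 t * casf (shiftv s1 u) * casf (shiftv s2 v) = 0.
Proof.
move=> Kv u w; case: N K v Kv @u @w => [|n] K v Kv u w.
  by rewrite !casf0 !casg0 !cash0 !cass0 /Qpol /Rpol; ring.
set p := kerp v.
pose a := - (e1 + t); pose b := e2 + e1 * t + t ^+ 2.
pose c := - (e3 + e2 * t + e1 * t ^+ 2 + t ^+ 3).
(* [P = D' p], where [D'] is the quotient of [D] by [X + t] and [- (c * t)] the
   remainder. *)
pose P := 'X * ('X * ('X * p)) + a%:P * ('X * ('X * p)) + b%:P * ('X * p)
          + c%:P * p.
have uP : pcomb u P = 0.
  rewrite -pcomb_XD.
  have -> : ('X + t%:P) * P =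
      ('X * ('X * ('X * ('X * p))) - e1%:P * ('X * ('X * ('X * p)))
       + e2%:P * ('X * ('X * p)) - e3%:P * ('X * p)) + (c * t)%:P * p.
    by rewrite /P /a /b /c; ring.
  rewrite linearD /= (pcomb_quartic _ Kv) pcomb_mulC pcomb_kerp.
  by rewrite mulmx0 scaler0 addr0.
have PE k : P`_k.+2 = ('X * p)`_k + a * p`_k + b * p`_k.+1 + c * p`_k.+2.
  by rewrite /P !coefD !coefCM !coefXM.
have p0 k : (n.+1 < k)%N -> p`_k = 0.
  by move=> nk; rewrite nth_default // (leq_trans (size_kerp v)).
have [p2 p3 p4] : [/\ p`_n.+2 = 0, p`_n.+3 = 0 & p`_n.+4 = 0].
  by split; apply: p0; rewrite // !ltnS leqW.
have szP : (size P <= n.+4.+1)%N.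
  apply/leq_sizeP => -[|[|[|j]]] // nj; have {}nj : (n.+1 < j)%N by [].
  by rewrite PE coefXM /= !p0 ?leqW // !mulr0 !addr0.
(* The value of [D'] at [- r] is [- Rpol e1 e2 e3 r t]. *)
have hornP r :
    P.[- r] = - Rpol e1 e2 e3 r t * ((-1) ^+ n.+1 * casf (shiftv r v)).
  rewrite casfE -horner_kerp -/p /P !hornerE /= /Rpol /a /b /c.
  by ring.
clearbody P.
(* Two successive divisions, as in Newton interpolation at [- s1] and [- s2]; the top three
   coefficients of [q] are needed below. *)
have [q1 [Pq1 szq1 q1E]] := horner_rem s1 szP.
have [q [q1q szq qE]] := horner_rem s2 szq1.
have q1S i : q1`_i = P`_i.+1 - s1 * q1`_i.+1 by rewrite q1E addrK.
have qS i : q`_i = q1`_i.+1 - s2 * q`_i.+1 by rewrite qE addrK.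
have q1n3 : q1`_n.+3 = casf v.
  rewrite q1S PE coefXM [q1`_n.+4](nth_default _ szq1) p2 p3 p4.
  by rewrite [p`_n.+1]kerp_lead !mulr0 !addr0 subr0.
have q1n2 : q1`_n.+2 = - casg v + (a - s1) * casf v.
  rewrite q1S q1n3 PE coefXM /= p2 p3 [p`_n.+1]kerp_lead [p`_n]kerp_sublead.
  by ring.
have q1n1 :
    q1`_n.+1 = cass v - (a - s1) * casg v + (b - s1 * (a - s1)) * casf v.
  rewrite q1S q1n2 PE kerp_subsublead p2 [p`_n.+1]kerp_lead [p`_n]kerp_sublead.
  by ring.
have qn2 : q`_n.+2 = casf v by rewrite qS q1n3 (nth_default _ szq) mulr0 subr0.
have qn1 : q`_n.+1 = - casg v + (a - s1 - s2) * casf v.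
  by rewrite qS q1n2 qn2; ring.
have qn0 := qS n; rewrite q1n1 qn1 in qn0.
have PE2 : P.[- s2] = P.[- s1] + (s1 - s2) * q1.[- s2].
  by rewrite {1}Pq1 !hornerE [- s2 + _]addrC.
(* Lagrange form of the remainder, multiplied by [s1 - s2] because this need not be invertible in
   [C]. *)
have P_interp : (s1 - s2)%:P * P =
    ('X + s1%:P) * P.[- s2]%:P - ('X + s2%:P) * P.[- s1]%:P
    + (s1 - s2)%:P * (('X + s1%:P) * (('X + s2%:P) * q)).
  by rewrite {1}Pq1 {1}q1q PE2; ring.
have := congr1 (fun R => lastdet w (pcomb u R)) P_interp.
rewrite /= pcomb_mulC uP scaler0 linear0 !(linearB, linearD) /= pcomb_mulC.
rewrite !pcomb_XD !pcombC !linearZ /= -/w lastdet_shiftv.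
(* Exchanging the two shifts exhibits [w] as the [s1]-shift of [shiftv s2 u]. *)
have -> : lastdet w (shiftv s2 u 0) = (-1) ^+ n * casf (shiftv s2 u).
  by rewrite -(lastdet_shiftv s1); apply: eq_lastdet => j _; apply: shiftvC.
rewrite (@lastdet_pcomb n 3) ?addn3 // !big_ord_recl big_ord0 addr0 /= /bump /=.
rewrite addn0 addn1 addn2 -casfE_last -casgE -cashE qn0 qn1 qn2 !hornP.
rewrite -!(mulrA (- Rpol _ _ _ _ _)) !signr_SM => H0.
by rewrite [RHS]H0 /Qpol /a /b; ring.
Qed.

End Casoratian.

(** * Return to the lattice variables *)

Theorem theorem4p2 (C : numClosedFieldType) (al1 al2 al3 delta p q a b : C)
  (hpq : p != q) (hpa : p != a) (hpb : p != b) (hqa : q != a) (hqb : q != b)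
  (hab : a != b)
  (N : nat) (phi : int -> int -> int -> int -> nat -> 'cV[C]_N)
  (K : 'M[C]_N) :
  let s1 := p - delta in let s2 := q - delta in
  let s3 := a - delta in let s4 := b - delta in
  let e1 := 4%:R * delta - al3 in
  let e2 := 6%:R * delta ^+ 2 - 3%:R * delta * al3 + al2 in
  let e3 := 4%:R * delta ^+ 3 - 3%:R * delta ^+ 2 * al3 + 2%:R * delta * al2 - al1 in
  (forall n m x y l, s1 *: phi (n - 1) m x y l
                     = phi n m x y l - phi (n - 1) m x y l.+1) ->
  (forall n m x y l, s2 *: phi n (m - 1) x y l
                     = phi n m x y l - phi n (m - 1) x y l.+1) ->
  (forall n m x y l, s3 *: phi n m (x - 1) y l
                     = phi n m x y l - phi n m (x - 1) y l.+1) ->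
  (forall n m x y l, s4 *: phi n m x (y - 1) l
                     = phi n m x y l - phi n m x (y - 1) l.+1) ->
  (forall n m x y l, K *m phi n m x y l
     = phi n m x y l.+4 - e1 *: phi n m x y l.+3 + e2 *: phi n m x y l.+2
       - e3 *: phi n m x y l.+1) ->
  let f n m x y := casor (phi n m x y) (fidx N) in
  let g n m x y := casor (phi n m x y) (gidx N) in
  let h n m x y := casor (phi n m x y) (hidx N) in
  let s n m x y := casor (phi n m x y) (sidx N) in
  forall (n m x y : int),
  (* tilde: n+1, hat: m+1, check: x-1 (x plays the role of alpha) *)
  let F := f n m x y in let G := g n m x y in let H := h n m x y in
  let Sv := s n m x y in
  let Ft := f (n + 1) m x y in let Gt := g (n + 1) m x y in
  let St := s (n + 1) m x y in
  let Fh := f n (m + 1) x y in let Gh := g n (m + 1) x y in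
  let Sh := s n (m + 1) x y in
  let Fc := f n m (x - 1) y in let Gc := g n m (x - 1) y in
  let Sc := s n m (x - 1) y in
  let Ftc := f (n + 1) m (x - 1) y in let Gtc := g (n + 1) m (x - 1) y in
  let Stc := s (n + 1) m (x - 1) y in
  let Fhc := f n (m + 1) (x - 1) y in let Ghc := g n (m + 1) (x - 1) y in
  let Shc := s n (m + 1) (x - 1) y in
  let Fth := f (n + 1) (m + 1) x y in let Gth := g (n + 1) (m + 1) x y in
  let Hth := h (n + 1) (m + 1) x y in
  (F * (s3 * Ftc + Gtc) + (s1 - s3) * Ft * Fc - (s1 * F + G) * Ftc = 0) /\
      (F * (s3 * Fhc + Ghc) + (s2 - s3) * Fh * Fc - (s2 * F + G) * Fhc = 0) /\
      (F * (s3 ^+ 2 * Ftc + s3 * Gtc + Stc) - s1 * F * (s3 * Ftc + Gtc)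
        + (s1 - s3) * Ft * (s3 * Fc + Gc) - Ftc * Sv = 0) /\
      (F * (s3 ^+ 2 * Fhc + s3 * Ghc + Shc) - s2 * F * (s3 * Fhc + Ghc)
        + (s2 - s3) * Fh * (s3 * Fc + Gc) - Fhc * Sv = 0) /\
      (Ft * (s1 * G + H) - Gt * (s1 * F + G) + F * St = 0) /\
      (Fh * (s2 * G + H) - Gh * (s2 * F + G) + F * Sh = 0) /\
      (      (s1 - s2) * (Ft * Fh - F * Fth) + Ft * Gh - Fh * Gt = 0) /\
      (      (Qpol e1 e2 s1 s2 * Fc * Fth + Fc * Hth - (s1 + s2 + e1) * Fc * Gth
        + ((s1 + s2 + e1) * Fth - Gth) * (s3 * Fc + Gc)
        + Fth * (s3 ^+ 2 * Fc + s3 * Gc + Sc)) * (s1 - s2)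
      - Rpol e1 e2 e3 s1 s3 * Fh * Ftc + Rpol e1 e2 e3 s2 s3 * Ft * Fhc = 0).
Proof.
move=> s1 s2 s3 s4 e1 e2 e3 phi_n phi_m phi_x _ Kphi f g h s n m x y.
have nE n' m' x' y' : phi (n' + 1) m' x' y' =1 shiftv s1 (phi n' m' x' y').
  move=> l; have := phi_n (n' + 1) m' x' y' l.
  by rewrite addrK /shiftv => ->; rewrite [RHS]addrC subrK.
have mE n' m' x' y' : phi n' (m' + 1) x' y' =1 shiftv s2 (phi n' m' x' y').
  move=> l; have := phi_m n' (m' + 1) x' y' l.
  by rewrite addrK /shiftv => ->; rewrite [RHS]addrC subrK.
(* With base point [x - 1], every family in the equations is obtained from [v] by forward shifts. *)
pose v := phi n m (x - 1) y.
have eq_shiftv r (u u' : nat -> 'cV[C]_N) :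
    u =1 u' -> shiftv r u =1 shiftv r u'.
  by move=> uu l; rewrite /shiftv !uu.
have x0 : phi n m x y =1 shiftv s3 v.
  by move=> l; rewrite /shiftv phi_x [RHS]addrC subrK.
have xt : phi (n + 1) m x y =1 shiftv s1 (shiftv s3 v).
  by move=> l; rewrite nE; apply: eq_shiftv.
have xh : phi n (m + 1) x y =1 shiftv s2 (shiftv s3 v).
  by move=> l; rewrite mE; apply: eq_shiftv.
have xth : phi (n + 1) (m + 1) x y =1 shiftv s2 (shiftv s1 (shiftv s3 v)).
  by move=> l; rewrite mE; apply: eq_shiftv.
have vt := nE n m (x - 1) y; have vh := mE n m (x - 1) y.
cbv zeta; rewrite /f /g /h /s !(eq_casor _ x0, eq_casor _ xt, eq_casor _ xh,
  eq_casor _ xth, eq_casor _ vt, eq_casor _ vh) -/v.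
set u := shiftv s3 v.
split; first exact: casf_casg_shift.
split; first exact: casf_casg_shift.
split; first exact: casg_cass_shift.
split; first exact: casg_cass_shift.
split; first exact: casf_cash_shift.
split; first exact: casf_cash_shift.
split; last exact: (casf_quartic_shift s1 s2 s3 (Kphi n m (x - 1) y)).
(* The equation in tilde and hat is, up to sign, the first one with base [u] and [s2] in place of
   [s3]. *)
have H := casf_casg_shift s1 s2 u.
rewrite [casf (shiftv s1 (shiftv s2 u))](eq_casor _ (shiftvC s1 s2 u)) in H.
rewrite -[RHS]oppr0 -[X in _ = - X]H /casf /casg; ring.
Qed.
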